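(* Suppose that for every positive integer $n$ the following holds: if a system $\mathcal{S}\subseteq B_n$ has exactly one solution in positive integers $x_1,\ldots,x_n$, then $x_1,\ldots,x_n \leqslant g(2n)$ for this solution. Then there exists an algorithm which takes as input a Diophantine equation $D(x_1,\ldots,x_p)=0$ and returns a positive integer $d$ with the following property: for all positive integers $a_1,\ldots,a_p$, if $(a_1,\ldots,a_p)$ is the unique solution of the equation $D(x_1,\ldots,x_p)=0$ in positive integers, then $a_1,\ldots,a_p \leqslant d$.
   Context: For a positive integer $n$, $B_n=\{x_i \cdot x_j=x_k,\ x_i+1=x_k : i,j,k \in \{1,\ldots,n\}\}$, a finite set of equations in the variables $x_1,\ldots,x_n$ (the indices need not be distinct). The function $g$ on positive integers is defined by $g(1)=1$ and $g(n+1)=2^{2^{g(n)}}$ for every positive integer $n$. A Diophantine equation $D(x_1,\ldots,x_p)=0$ is given by a polynomial $D$ with integer coefficients, where $p$ is a positive integer (also part of the input). *)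

(* Defs.v *)
From HB Require Import structures.
From mathcomp Require Import all_boot all_order all_algebra.
From mathcomp Require Import mpoly.

Set Implicit Arguments.
Unset Strict Implicit.
Unset Printing Implicit Defensive.

Import Order.TTheory GRing.Theory Num.Theory.

Local Open Scope nat_scope.

(* Positive integers are natural numbers [m] with an explicit [0 < m]. *)

(* [g 1 = 1] and [g n.+1 = 2 ^ 2 ^ g n] for [0 < n]; the value [g 0 = 1] is
   junk. *)
Definition g (n : nat) : nat := iter n.-1 (fun m => 2 ^ (2 ^ m)) 1.

(* The variables x_1, ..., x_n are indexed by ['I_n].
   [inl (i, j, k)] is the equation x_i * x_j = x_k,
   [inr (i, k)] is the equation x_i + 1 = x_k.
   Every value of this finite type is one of the equations of B_n, so that
   [{set Beq n}] is the type of the systems S included in B_n. *)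
Definition Beq (n : nat) : finType := ('I_n * 'I_n * 'I_n + 'I_n * 'I_n)%type.

Definition Beq_holds (n : nat) (x : {ffun 'I_n -> nat}) (e : Beq n) : Prop :=
  match e with
  | inl (i, j, k) => x i * x j = x k
  | inr (i, k) => x i + 1 = x k
  end.

Definition Bsystem_solution (n : nat) (S : {set Beq n})
    (x : {ffun 'I_n -> nat}) : Prop :=
  (forall i, 0 < x i) /\ (forall e, e \in S -> Beq_holds x e).

Definition dioph_solution (p : nat) (D : {mpoly int[p]})
    (a : {ffun 'I_p -> nat}) : Prop :=
  (forall i, 0 < a i) /\ D.@[fun i => (a i)%:Z]%R = 0%R.

(* Algorithms are mu-recursive functions: [recfun n] is the type of programs
   with [n] arguments. *)
Inductive recfun : nat -> Type :=
  | RZero n : recfun n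
  | RSucc : recfun 1
  | RProj n : 'I_n -> recfun n
  | RComp m n : recfun m -> ('I_m -> recfun n) -> recfun n
  | RPrim n : recfun n -> recfun n.+2 -> recfun n.+1
  | RMin n : recfun n.+1 -> recfun n.

(* [computes f v y]: the program [f] terminates on the input [v] with value [y].
   - [RPrim f h] has value [f u] at [0 :: u] and [h (k :: r :: u)] at
     [k.+1 :: u], where [r] is its value at [k :: u]; the function [s] below is
     the sequence of values at [0 :: u], [1 :: u], up to the first argument.
   - [RMin f] is unbounded search: the least [y] with [f (y :: v) = 0], all
     previous values of [f] being defined and nonzero. *)
Fixpoint computes (n : nat) (f : recfun n) : n.-tuple nat -> nat -> Prop :=
  match f in recfun n return n.-tuple nat -> nat -> Prop with
  | RZero _ => fun _ y => y = 0
  | RSucc => fun v y => y = (thead v).+1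
  | RProj _ i => fun v y => y = tnth v i
  | RComp m _ f hs => fun v y =>
      exists w : m.-tuple nat,
        (forall i, computes (hs i) v (tnth w i)) /\ computes f w y
  | RPrim n f h => fun v y =>
      let u : n.-tuple nat := [tuple of behead v] in
      exists s : nat -> nat,
        [/\ computes f u (s 0),
            forall k, k < thead v ->
              computes h [tuple of k :: s k :: u] (s k.+1)
          & y = s (thead v)]
  | RMin _ f => fun v y =>
      computes f [tuple of y :: v] 0 /\
      forall k, k < y -> exists z, computes f [tuple of k :: v] z.+1
  end.

(* The input of an algorithm: the number of unknowns and the polynomial.
   The list consisting of [p], followed, for each monomial of the support of [D]
   in increasing order, by the code of its coefficient and its [p]
   exponents, is coded as one natural number by the bijection
   [CodeSeq.code : seq nat -> nat]. *)
Definition code_int (z : int) : nat :=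
  match z with
  | Posz m => m.*2
  | Negz m => m.*2.+1
  end.

Definition code_dioph (p : nat) (D : {mpoly int[p]}) : nat :=
  CodeSeq.code
    (p :: flatten [seq code_int D@_m :: [seq m i | i <- enum 'I_p]
                  | m : 'X_{1..p} <- sort <=%O (msupp D)]).

(* Main.v *)
Require Import Defs.
From HB Require Import structures.
From mathcomp Require Import all_boot all_order all_algebra.
From mathcomp Require Import mpoly zify ring.

Set Implicit Arguments.
Unset Strict Implicit.
Unset Printing Implicit Defensive.

Import GRing.Theory.

(** The algorithm does not look inside the equation.  It returns [g (2 * N)],
    where [N] is a linear function of the code of [D], so large that every
    equation [D = 0] with a unique solution translates into a system included
    in some [B_n] with a unique solution and [n <= N]: the code of a list is
    at least the sum of its entries plus its length, hence controls at once
    the number of unknowns, the coefficients and the exponents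
    ([code_dioph_ge]).

    Write [D = P - Q] where [P] and [Q] have positive values, and let [a] be
    the unique solution.  The unknowns of the system are indexed by a set [W]
    of positive integers: the [a i], the values at [a] of all subterms of [P]
    and [Q], and the values of a few more terms for each addition.  The system
    consists of all the equations [u * v = w] and [u + 1 = w] that are true
    between elements of [W].  One of its solutions is the identity of [W].
    A solution is the same as a map [y] on [W] that respects those products and
    successors; such a map also respects the additions of the terms, since
    addition of positive integers is definable from product and successor:
    [s = u + v] if and only if
    [(s * u + 1) * (s * v + 1) = s ^ 2 * (u * v + 1) + 1].
    Therefore [y] sends the value of a term at [a] to its value at
    [b := y \o a] ([morphism_eval]).  As [P] and [Q] have the same value at
    [a], they have the same value at [b]; so [b] is a solution of [D = 0],
    [b = a], and [y] is the identity ([unique_solution_rigid]).  The assumed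
    bound applied to this system bounds all the elements of [W]
    ([rigid_le_g]).  The set [W] depends on the unknown solution [a], but its
    size is bounded in terms of [D] alone.  Indexing the unknowns by values
    instead of terms also makes the equation [P = Q] automatic. *)

Local Open Scope nat_scope.

(** * Computable functions of one argument, and the bound [g] *)

Definition computable (f : nat -> nat) : Prop :=
  exists A : recfun 1, forall k, computes A [tuple k] (f k).

Lemma computable_succ : computable succn.
Proof. by exists RSucc. Qed.

Lemma computable_comp (f h : nat -> nat) :
  computable f -> computable h -> computable (fun k => f (h k)).
Proof.
move=> [A compA] [B compB]; exists (RComp A (fun _ => B)) => k /=.
by exists [tuple h k]; split=> // i; rewrite (ord1 i).
Qed.

Lemma computes_const (c : nat) : exists C : recfun 0, forall v, computes C v c.
Proof.
elim: c => [|c [C compC]]; first by exists (RZero 0).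
exists (RComp RSucc (fun _ => C)) => v /=.
by exists [tuple c]; split=> // i; rewrite (ord1 i).
Qed.

(** Towers of exponentials are iterated compositions of iterates of the
    successor, so closure under composition and iteration is all that the
    bound [g] needs. *)
Lemma computable_iter (f : nat -> nat) (c : nat) :
  computable f -> computable (fun k => iter k f c).
Proof.
move=> [A compA]; have [C compC] := computes_const c.
exists (RPrim C (RComp A (fun _ => RProj (lift ord0 ord0)))) => k /=.
exists (fun j => iter j f c); split=> // j _.
by exists [tuple iter j f c]; split=> // i; rewrite (ord1 i).
Qed.

Lemma computable_ext (f h : nat -> nat) :
  f =1 h -> computable f -> computable h.
Proof. by move=> fh [A compA]; exists A => k; rewrite -fh. Qed.

Lemma computable_affine (q r : nat) : computable (fun k => q * k + r).
Proof.
have: computable (fun k => iter k (addn q) r).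
  apply: computable_iter.
  apply: (computable_ext (f := fun k => iter k succn q)).
    by move=> k; rewrite iter_succn.
  exact/computable_iter/computable_succ.
apply: computable_ext => k; by rewrite iter_addn addnC mulnC.
Qed.

Lemma computable_pow2 : computable (expn 2).
Proof.
have: computable (fun k => iter k (muln 2) 1).
  apply: computable_iter; apply: computable_ext (computable_affine 2 0) => k.
  by rewrite addn0.
apply: computable_ext => k; by rewrite iter_muln muln1.
Qed.

(** The hypothesis is about [(h k).-1] because [g n] iterates [n.-1] times and
    predecessor is not among the basic functions. *)
Lemma computable_g (h : nat -> nat) :
  computable (fun k => (h k).-1) -> computable (fun k => g (h k)).
Proof.
move=> hP; pose e k := 2 ^ (2 ^ k).
apply: (@computable_comp (fun k => iter k e 1) _ _ hP).
exact/computable_iter/computable_comp/computable_pow2/computable_pow2.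
Qed.

Lemma g_gt0 (n : nat) : 0 < g n.
Proof. by rewrite /g; case: n.-1 => [|k] //=; rewrite expn_gt0. Qed.

Lemma g_le (m n : nat) : m <= n -> g m <= g n.
Proof.
move=> le_mn; rewrite /g; have /subnKC <-: m.-1 <= n.-1 by lia.
elim: (n.-1 - m.-1) => [|k IHk]; first by rewrite addn0.
rewrite addnS iterS; apply: leq_trans IHk _.
by apply: leq_trans (ltnW (ltn_expl _ _)) (ltnW (ltn_expl _ _)).
Qed.

(** * Systems given by the arithmetic of a finite set of integers *)

(** The solutions of the system of all true equations between elements of [W],
    seen as functions on all integers so that [W] need not be a type. *)
Definition partial_morphism (W : seq nat) (y : nat -> nat) : Prop :=
  [/\ forall u, u \in W -> 0 < y u,
      forall u v, u \in W -> v \in W -> u * v \in W -> y (u * v) = y u * y v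
    & forall u, u \in W -> u.+1 \in W -> y u.+1 = (y u).+1].

Definition rigid (W : seq nat) : Prop :=
  forall y, partial_morphism W y -> {in W, forall u, y u = u}.

(** Rigidity says that the identity is the only solution of the system of all
    true equations between elements of [W], so that the bound applies to it.
    Duplicates are removed from [W] first, for otherwise two unknowns would
    stand for the same integer without an equation that forces them to be
    equal. *)
Lemma rigid_le_g :
  (forall n : nat, 0 < n ->
     forall (S : {set Beq n}) (x : {ffun 'I_n -> nat}),
       unique (Bsystem_solution S) x -> forall i : 'I_n, x i <= g (2 * n)) ->
  forall W : seq nat, {in W, forall u, 0 < u} -> rigid W ->
  {in W, forall u, u <= g (2 * size W)}.
Proof.
move=> bound W0 W0_gt0 W0rigid u; rewrite -mem_undup => Wu.
set W := undup W0 in Wu *.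
have memW v : (v \in W) = (v \in W0) by rewrite mem_undup.
have ltW v : v \in W -> index v W < size W by rewrite index_mem.
pose x : {ffun 'I_(size W) -> nat} := [ffun i : 'I_(size W) => nth 0 W i].
have xW i : x i \in W by rewrite ffunE mem_nth.
have xE v (Wv : v \in W) : x (Ordinal (ltW v Wv)) = v.
  by rewrite ffunE nth_index.
pose holds (e : Beq (size W)) := match e with
  | inl (i, j, k) => x i * x j == x k
  | inr (i, k) => x i + 1 == x k
  end.
have holdsP e : reflect (Beq_holds x e) (holds e).
  by case: e => [[[i j] k]|[i k]]; apply: eqP.
have n_gt0 : 0 < size W by apply: leq_ltn_trans (ltW u Wu).
apply: leq_trans (_ : g (2 * size W) <= _); last first.
  by rewrite g_le // leq_mul2l size_undup orbT.
rewrite -(xE u Wu); apply: (bound _ n_gt0 [set e | holds e]).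
split=> [|x' [x'_gt0 x'P]].
  split=> [i|e]; first by rewrite W0_gt0 // -memW.
  by rewrite inE => /holdsP.
pose y v := if insub (index v W) is Some i then x' i else 0.
have yE v (Wv : v \in W) : y v = x' (Ordinal (ltW v Wv)).
  rewrite /y; case: insubP => [i _ iE|]; last by rewrite ltW.
  by congr (x' _); apply/val_inj.
have yx i : y (x i) = x' i.
  rewrite (yE _ (xW i)); congr (x' _); apply/val_inj => /=.
  by rewrite ffunE index_uniq ?undup_uniq.
apply/ffunP => i; rewrite -yx; apply/esym/W0rigid; last by rewrite -memW.
split=> [v|v w|v]; rewrite -!memW.
- by move=> Wv; rewrite (yE v Wv).
- move=> Wv Ww Wvw; rewrite (yE _ Wv) (yE _ Ww) (yE _ Wvw); apply/esym.
  apply: (x'P (inl (_, _, _))); rewrite inE /=; apply/eqP.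
  by rewrite !xE.
- move=> Wv Wv1; rewrite (yE _ Wv) (yE _ Wv1) -[RHS]addn1; apply/esym.
  apply: (x'P (inr (_, _))); rewrite inE /=; apply/eqP.
  by rewrite !xE addn1.
Qed.

(** * Terms and their values under partial morphisms *)

Section Expressions.

Variable p : nat.

Inductive expr : Type :=
  | Var of 'I_p
  | One
  | Succ of expr
  | Mul of expr & expr
  | Add of expr & expr.

Lemma expr_comparable : comparable expr.
Proof.
by move=> e f; rewrite /decidable; decide equality; apply: eq_comparable.
Qed.

HB.instance Definition _ := hasDecEq.Build expr (compareP expr_comparable).

Fixpoint eval (a : 'I_p -> nat) (e : expr) : nat :=
  match e with
  | Var i => a i
  | One => 1
  | Succ e => (eval a e).+1
  | Mul e f => eval a e * eval a f
  | Add e f => eval a e + eval a f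
  end.

Lemma eq_eval (a b : 'I_p -> nat) : a =1 b -> eval a =1 eval b.
Proof.
by move=> ab; elim=> [i||e IHe|e IHe f IHf|e IHe f IHf] /=; rewrite ?IHe ?IHf.
Qed.

Lemma eval_gt0 (a : 'I_p -> nat) (e : expr) :
  (forall i, 0 < a i) -> 0 < eval a e.
Proof.
move=> a_gt0; elim: e => //= e He f Hf; first by rewrite muln_gt0 He.
by rewrite addn_gt0 He.
Qed.

(** The terms that occur in the two sides of the identity of
    [sum_characterization] at [s = e + f].  The right-hand side itself needs
    no entry: its value is that of [Mul (Succ (Mul s e)) (Succ (Mul s f))]. *)
Definition sum_witnesses (e f : expr) : seq expr :=
  let s := Add e f in
  [:: s; Mul s e; Succ (Mul s e); Mul s f; Succ (Mul s f);
      Mul (Succ (Mul s e)) (Succ (Mul s f));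
      Mul e f; Succ (Mul e f); Mul s s; Mul (Mul s s) (Succ (Mul e f))].

(** The terms whose values suffice to pin down that of [e] by products and
    successors alone. *)
Fixpoint arith_closure (e : expr) : seq expr :=
  match e with
  | Var _ | One => [:: e]
  | Succ f => e :: arith_closure f
  | Mul f h => e :: arith_closure f ++ arith_closure h
  | Add f h => sum_witnesses f h ++ arith_closure f ++ arith_closure h
  end.

Lemma mem_arith_closure (e : expr) : e \in arith_closure e.
Proof. by case: e => *; rewrite inE eqxx. Qed.

(** Julia Robinson's definition of addition: after expansion, the hypothesis
    is [s * (u + v) = s * s]. *)
Lemma sum_characterization (s u v : nat) : 0 < s ->
  (s * u).+1 * (s * v).+1 = (s * s * (u * v).+1).+1 -> s = u + v.
Proof.
move=> s_gt0 E.
have: s * s = s * (u + v) by move: E; rewrite !mulSn !mulnS; nia.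
by move/eqP; rewrite eqn_pmul2l // => /eqP.
Qed.

(** A partial morphism commutes with the evaluation of terms whose auxiliary
    values all belong to its domain.  For sums, apply [y] to both sides of the
    identity of [sum_characterization]; this uses only products and successors,
    and the characterization then gives [y (u + v) = y u + y v]. *)
Lemma morphism_eval (a : 'I_p -> nat) (W : seq nat) (y : nat -> nat) e :
    partial_morphism W y -> (forall i, 0 < a i) ->
    {in arith_closure e, forall f, eval a f \in W} ->
  {in arith_closure e, forall f, y (eval a f) = eval (fun i => y (a i)) f}.
Proof.
move=> [y_gt0 yM yS] a_gt0; set b := fun i => y (a i).
pose good f := y (eval a f) = eval b f.
have goodS f : eval a f \in W -> eval a (Succ f) \in W ->
  good f -> good (Succ f).
  by move=> Wf WSf gf; rewrite /good /= yS // gf.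
have goodM f h : eval a f \in W -> eval a h \in W -> eval a (Mul f h) \in W ->
    good f -> good h -> good (Mul f h).
  by move=> Wf Wh Wfh gf gh; rewrite /good /= yM // gf gh.
elim: e => [i||e IHe|e IHe f IHf|e IHe f IHf] We h.
- by rewrite inE => /eqP ->.
- (* [1 * 1 = 1] forces [y 1 * y 1 = y 1], that is, [y 1 = 1]. *)
  rewrite inE => /eqP -> /=; have W1 := We _ (mem_arith_closure One).
  have /eqP := yM 1 1 W1 W1 W1.
  by rewrite /= -{1}[y 1]muln1 eqn_pmul2l ?y_gt0 // => /eqP.
- have We' : {in arith_closure e, forall f, eval a f \in W}.
    by move=> f ef; apply: We; rewrite inE ef orbT.
  rewrite inE => /orP[/eqP ->|/(IHe We') //].
  apply: goodS (IHe We' _ (mem_arith_closure e)).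
    exact/We'/mem_arith_closure.
  exact/We/mem_arith_closure.
- have We' : {in arith_closure e, forall h, eval a h \in W}.
    by move=> h' eh'; apply: We; rewrite inE mem_cat eh' orbT.
  have Wf' : {in arith_closure f, forall h, eval a h \in W}.
    by move=> h' fh'; apply: We; rewrite inE mem_cat fh' !orbT.
  rewrite inE mem_cat => /or3P[/eqP ->|/(IHe We') //|/(IHf Wf') //].
  apply: goodM (IHe We' _ (mem_arith_closure e))
               (IHf Wf' _ (mem_arith_closure f)).
  + exact/We'/mem_arith_closure.
  + exact/Wf'/mem_arith_closure.
  + exact/We/mem_arith_closure.
have We' : {in arith_closure e, forall h, eval a h \in W}.
  by move=> h' eh'; apply: We; rewrite !mem_cat eh' orbT.
have Wf' : {in arith_closure f, forall h, eval a h \in W}.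
  by move=> h' fh'; apply: We; rewrite !mem_cat fh' !orbT.
rewrite /= -[_ :: _]/(sum_witnesses e f ++ _) !mem_cat.
case/or3P => [h_in|/(IHe We') //|/(IHf Wf') //].
have Ws : all (fun h => eval a h \in W) (sum_witnesses e f).
  by apply/allP => k ek; apply: We; rewrite mem_cat ek.
have ge : good e := IHe We' _ (mem_arith_closure e).
have gf : good f := IHf Wf' _ (mem_arith_closure f).
have Wve : eval a e \in W by exact/We'/mem_arith_closure.
have Wvf : eval a f \in W by exact/Wf'/mem_arith_closure.
move: Ws h_in; rewrite /sum_witnesses; set s := Add e f.
case/and5P => Ws Wse WSse Wsf /and5P[WSsf Wprod Wef WSef /and3P[Wss Wrhs _]].
have sumE : eval a (Mul (Succ (Mul s e)) (Succ (Mul s f)))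
          = eval a (Succ (Mul (Mul s s) (Succ (Mul e f)))) by rewrite /=; ring.
have WSrhs : eval a (Succ (Mul (Mul s s) (Succ (Mul e f)))) \in W.
  by rewrite -sumE.
have yMul h1 h2 : eval a h1 \in W -> eval a h2 \in W ->
  eval a (Mul h1 h2) \in W ->
  y (eval a (Mul h1 h2)) = y (eval a h1) * y (eval a h2) by exact: yM.
have ySucc h1 : eval a h1 \in W -> eval a (Succ h1) \in W ->
  y (eval a (Succ h1)) = (y (eval a h1)).+1 by exact: yS.
have gs : good s.
  rewrite /good [RHS]/= -ge -gf.
  apply: sum_characterization; first exact: y_gt0.
  rewrite -!yMul // -!ySucc // -!yMul // -ySucc //.
  by rewrite sumE.
have gse := goodM _ _ Ws Wve Wse gs ge; have gSse := goodS _ Wse WSse gse.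
have gsf := goodM _ _ Ws Wvf Wsf gs gf; have gSsf := goodS _ Wsf WSsf gsf.
have gef := goodM _ _ Wve Wvf Wef ge gf; have gSef := goodS _ Wef WSef gef.
have gss := goodM _ _ Ws Ws Wss gs gs.
have gprod := goodM _ _ WSse WSsf Wprod gSse gSsf.
have grhs := goodM _ _ Wss WSef Wrhs gss gSef.
by rewrite !inE => h_in; repeat (case/orP: h_in => [/eqP-> //|h_in]);
  move/eqP: h_in => ->.
Qed.

End Expressions.

Arguments One {p}.

(** * Diophantine equations as equalities between two terms *)

Definition pos_part (z : int) : nat := if z is Posz k then k else 0.
Definition neg_part (z : int) : nat := if z is Negz k then k.+1 else 0.

Lemma pos_part_sub_neg_part (z : int) :
  ((pos_part z)%:Z - (neg_part z)%:Z)%R = z.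
Proof. by case: z => k /=; rewrite ?subr0 ?sub0r ?NegzE. Qed.

Lemma pos_part_le_code (z : int) : pos_part z <= code_int z.
Proof. by case: z => k //=; lia. Qed.

Lemma neg_part_le_code (z : int) : neg_part z <= code_int z.
Proof. by case: z => k //=; lia. Qed.

Section Polynomials.

Variable p : nat.
Implicit Types (m : 'X_{1..p}) (a : 'I_p -> nat) (D : {mpoly int[p]}).

Definition monomial_expr m : expr p :=
  foldr (fun i e => iter (m i) (Mul (Var i)) e) One (enum 'I_p).

Lemma eval_monomial_expr a m :
  eval a (monomial_expr m) = \prod_i a i ^ m i.
Proof.
rewrite /monomial_expr -[RHS]big_enum /=.
elim: (enum _) => [|i s IHs] /=; first by rewrite big_nil.
rewrite big_cons -IHs; elim: (m i) => [|k IHk]; first by rewrite mul1n.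
by rewrite iterS /= IHk expnS mulnA.
Qed.

Lemma size_arith_closure_monomial m :
  size (arith_closure (monomial_expr m)) =
    (2 * sumn [seq m i | i <- enum 'I_p]).+1.
Proof.
rewrite /monomial_expr.
elim: (enum _) => [|i s IHs] //=.
elim: (m i) => [|k IHk] //; rewrite iterS /= IHk; lia.
Qed.

(** The value is [1 + \sum_m (w m + 1) * X ^ m].  All coefficients are shifted
    by one to make them positive, since zero is not the value of a term; the
    shifts cancel in the difference of two such sums. *)
Definition poly_expr (w : 'X_{1..p} -> nat) (s : seq 'X_{1..p}) : expr p :=
  foldr (fun m e => Add (Mul (iter (w m) (@Succ p) One) (monomial_expr m)) e)
        One s.

Lemma eval_poly_expr a w s :
  eval a (poly_expr w s) = (\sum_(m <- s) (w m).+1 * \prod_i a i ^ m i).+1.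
Proof.
elim: s => [|m s IHs]; first by rewrite big_nil.
rewrite big_cons /= IHs eval_monomial_expr addnS; congr (_ * _ + _).+1.
by elim: (w m) => //= k ->.
Qed.

(** Each monomial costs 10 terms for the addition, 1 for the product by the
    coefficient, [w m + 1] for the coefficient and [2 * d + 1] for the power
    product of degree [d]; this is at most [13 * (w m + d + 1)]. *)
Lemma size_arith_closure_poly (w v : 'X_{1..p} -> nat) s :
    (forall m, w m <= v m) ->
  size (arith_closure (poly_expr w s)) <=
    13 * sumn [seq (sumn (v m :: [seq m i | i <- enum 'I_p])).+1 | m <- s] + 1.
Proof.
move=> wv; elim: s => //= m s IHs.
rewrite !size_cat size_arith_closure_monomial.
have -> : size (arith_closure (iter (w m) (@Succ p) One)) = (w m).+1.
  by elim: (w m) => //= k ->.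
by have := wv m; lia.
Qed.

(** In the order in which [code_dioph] lists them. *)
Definition monomials D := sort <=%O (msupp D).
Definition pos_expr D := poly_expr (fun m => pos_part D@_m) (monomials D).
Definition neg_expr D := poly_expr (fun m => neg_part D@_m) (monomials D).

Lemma dioph_solutionP D (a : {ffun 'I_p -> nat}) :
  dioph_solution D a <->
  (forall i, 0 < a i) /\ eval a (pos_expr D) = eval a (neg_expr D).
Proof.
suff E : D.@[fun i => (a i)%:Z]%R =
    ((eval a (pos_expr D))%:Z - (eval a (neg_expr D))%:Z)%R.
  rewrite /dioph_solution E; split=> -[a_gt0 Da]; split=> //.
    by move/eqP: Da; rewrite subr_eq0 => /eqP[].
  by rewrite Da subrr.
rewrite mevalE !eval_poly_expr !intS opprD addrACA subrr add0r.
rewrite -(perm_big _ (permEl (perm_sort <=%O (msupp D)))) /=.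
rewrite !(big_morph Posz PoszD (erefl _)) -sumrB.
apply: eq_bigr => m _; rewrite !PoszM -mulrBl !intS opprD addrACA subrr add0r.
rewrite pos_part_sub_neg_part (big_morph Posz PoszM (erefl _)); congr (_ * _)%R.
apply: eq_bigr => i _; elim: (m i) => // k IHk.
by rewrite expnS PoszM exprS IHk.
Qed.

End Polynomials.

(** * Size of the system in terms of the code *)

(** The code of [n :: s] is [2 ^ n * (2 * c + 1)], where [c] is the code of
    [s], and this is at least [n + 1 + c]. *)
Lemma code_ge_sumn (s : seq nat) : sumn s + size s <= CodeSeq.code s.
Proof.
elim: s => //= n s IHs.
by have := ltn_expl n (isT : 1 < 2); have := expn_gt0 2 n; nia.
Qed.

Lemma code_dioph_ge (p : nat) (D : {mpoly int[p]}) :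
  p + sumn [seq (sumn (code_int D@_m :: [seq m i | i <- enum 'I_p])).+1
           | m <- monomials D] + 1 <= code_dioph D.
Proof.
apply: leq_trans (code_ge_sumn _) => /=.
rewrite -/(monomials D) addn1 addnS ltnS -addnA leq_add2l.
elim: (monomials D) => //= m s IHs; rewrite sumn_cat size_cat; lia.
Qed.

(** A partial morphism [y] turns the solution [a] into the solution [y \o a],
    which must be [a] again; then [y] fixes the values at [a] of all terms. *)
Lemma unique_solution_rigid (p : nat) (D : {mpoly int[p]}) a :
    unique (dioph_solution D) a ->
  rigid (codom a ++ map (eval a) (arith_closure (pos_expr D) ++
                                  arith_closure (neg_expr D))).
Proof.
set W := _ ++ _; move=> [/dioph_solutionP[a_gt0 Da] a_uniq] y y_morph.
have WP : {in arith_closure (pos_expr D), forall e, eval a e \in W}.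
  by move=> e De; rewrite mem_cat map_f ?orbT // mem_cat De.
have WN : {in arith_closure (neg_expr D), forall e, eval a e \in W}.
  by move=> e De; rewrite mem_cat map_f ?orbT // mem_cat De orbT.
have yP := morphism_eval y_morph a_gt0 WP.
have yN := morphism_eval y_morph a_gt0 WN.
have ya i : y (a i) = a i.
  pose b := [ffun i => y (a i)].
  have bE : eval b =1 eval (fun i => y (a i)).
    by apply: eq_eval => j; rewrite ffunE.
  suff /a_uniq/ffunP/(_ i) : dioph_solution D b by rewrite ffunE => <-.
  apply/dioph_solutionP; split=> [j|].
    rewrite ffunE; case: y_morph => y_gt0 _ _.
    by rewrite y_gt0 // mem_cat codom_f.
  by rewrite !bE -yP ?mem_arith_closure // -yN ?mem_arith_closure // Da.
have ya_eval : eval (fun i => y (a i)) =1 eval a by exact: eq_eval.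
move=> u; rewrite mem_cat => /orP[/codomP[i ->] //|/mapP[e]].
by rewrite mem_cat => /orP[/yP|/yN] ye -> ; rewrite ye ya_eval.
Qed.

Theorem theorem2 :
  (forall n : nat, 0 < n ->
     forall (S : {set Beq n}) (x : {ffun 'I_n -> nat}),
       unique (Bsystem_solution S) x -> forall i : 'I_n, x i <= g (2 * n)) ->
  exists A : recfun 1,
    forall (p : nat) (D : {mpoly int[p]}), 0 < p ->
      exists d : nat,
        [/\ computes A [tuple code_dioph D] d, 0 < d
          & forall a : {ffun 'I_p -> nat},
              unique (dioph_solution D) a -> forall i : 'I_p, a i <= d].
Proof.
(* Two terms with at most [13 * c + 1] auxiliary terms each; the count of the
   unknowns is absorbed in [26 * c]. *)
move=> bound; pose N c := 26 * c + 2.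
have [A compA] : computable (fun c => g (2 * N c)).
  apply: computable_g; apply: computable_ext (computable_affine 52 3) => c.
  by rewrite /N; lia.
exists A => p D _; exists (g (2 * N (code_dioph D))).
split; [exact: compA | exact: g_gt0 | move=> a a_uniq i].
have W_rigid := unique_solution_rigid a_uniq.
have a_gt0 : forall i, 0 < a i by case: a_uniq => -[].
apply: leq_trans (rigid_le_g bound _ W_rigid _) _.
- move=> u; rewrite mem_cat => /orP[/codomP[j ->] //|/mapP[e _ ->]].
  exact: eval_gt0.
- by rewrite mem_cat codom_f.
apply: g_le; rewrite leq_mul2l /=.
rewrite size_cat size_codom card_ord size_map size_cat.
have := size_arith_closure_poly (monomials D) (fun m => pos_part_le_code D@_m).
have := size_arith_closure_poly (monomials D) (fun m => neg_part_le_code D@_m).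
have := code_dioph_ge D.
rewrite -/(pos_expr D) -/(neg_expr D) /N; lia.
Qed.
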